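(* For all $[S,f],[S',f']\in\mathcal{T}_1$, $$\kappa([S,f],[S',f'])=\lambda([S,f],[S',f']),$$ where $$\kappa([S,f],[S',f'])=\log\sup_{\alpha\in\mathcal{S}(\mathbb{T}^2)}\frac{\ell_{h'}(\alpha)}{\ell_{h}(\alpha)},\qquad \lambda([S,f],[S',f'])=\inf_{\varphi}\log\mathcal{L}(\varphi),$$ the infimum being over all Lipschitz maps $\varphi:S\to S'$ homotopic to $f'^{-1}\circ f$, and $h,h'$ being the area-$1$ flat metrics corresponding to $[S,f]$ and $[S',f']$.
   Context: Teichmüller space of the torus: let $\mathbb{T}^2=S_1=\mathbb{C}/(\mathbb{Z}+i\mathbb{Z})$ be the fixed oriented torus. $\mathcal{T}_1$ is the set of pairs $(S,f)$, with $S$ a closed Riemann surface of genus $1$ and $f:S\to\mathbb{T}^2$ an orientation-preserving homeomorphism (the marking), modulo the relation $(S,f)\sim(S',f')$ iff there is a conformal homeomorphism $k:S\to S'$ with $f'\circ k$ homotopic to $f$. Every such $S$ is conformally equivalent to some $\mathbb{C}/\Lambda$ of area $1$, $\Lambda\subset\mathbb{C}$ a lattice, and is given the flat metric of area $1$ induced from $\mathbb{C}$; this metric is transported to $\mathbb{T}^2$ by the marking $f$, and is denoted $h$ (respectively $h'$ for $[S',f']$). Curves: $\mathcal{S}(\mathbb{T}^2)$ is the set of isotopy classes of essential (not homotopic to a point) closed curves on $\mathbb{T}^2$. For $\alpha\in\mathcal{S}(\mathbb{T}^2)$, $\ell_h(\alpha)$ is the shortest $h$-length of a curve in the homotopy class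 $\alpha$; equivalently, the shortest length in $S$ of a curve in the class $f^{-1}(\alpha)$. Lipschitz constant: for a homeomorphism $\varphi:S\to S'$, with $d_{h},d_{h'}$ the distances of the flat metrics on $S,S'$, $\mathcal{L}(\varphi)=\sup_{x\neq y}\frac{d_{h'}(\varphi(x),\varphi(y))}{d_h(x,y)}$; when this is finite $\varphi$ is called a Lipschitz map. *)

(* Defs.v *)
From HB Require Import structures.
From mathcomp Require Import all_boot all_order all_algebra complex.
From mathcomp Require Import all_classical all_reals all_analysis.
Set Implicit Arguments.
Unset Strict Implicit.
Unset Printing Implicit Defensive.
Import Order.TTheory GRing.Theory Num.Theory.
Import numFieldNormedType.Exports.
Local Open Scope classical_set_scope.
Local Open Scope ring_scope.
Local Open Scope quotient_scope.

(* R[i], seen as a numFieldType so that it carries its topology and its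
   structure of normed module over itself; [derivable] is then complex
   differentiability. *)
Definition plane (R : realType) : numFieldType := R[i].

Definition modulus (R : realType) (z : plane R) : R :=
  ComplexField.Normc.normc z.

Definition polar (R : realType) (r t : R) : plane R :=
  Complex (r * cos t) (r * sin t).

Section Topology.
Context {R : realType}.

Record homeo (X Y : topologicalType) := Homeo {
  hfun :> X -> Y;
  hinv : Y -> X;
  hfunK : cancel hfun hinv;
  hinvK : cancel hinv hfun;
  hfun_continuous : continuous hfun;
  hinv_continuous : continuous hinv }.

Definition homotopic (X Y : topologicalType) (f g : X -> Y) : Prop :=
  exists H : R * X -> Y,
    [/\ {within `[0, 1]%classic `*` [set: X], continuous H},
        forall x, H (0, x) = f x
      & forall x, H (1, x) = g x].

(* A closed curve is a map on [0, 1]; its values elsewhere are irrelevant. *)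
Definition closed_curve (Y : topologicalType) (c : R -> Y) : Prop :=
  {within `[0, 1], continuous c} /\ c 0 = c 1.

Definition freely_homotopic (Y : topologicalType) (c1 c2 : R -> Y) : Prop :=
  exists H : R * R -> Y,
    [/\ {within `[0, 1]%classic `*` `[0, 1]%classic, continuous H},
        forall t, t \in `[0, 1] -> H (0, t) = c1 t,
        forall t, t \in `[0, 1] -> H (1, t) = c2 t
      & forall s, s \in `[0, 1] -> H (s, 0) = H (s, 1)].

Definition essential (Y : topologicalType) (c : R -> Y) : Prop :=
  ~ exists y : Y, freely_homotopic c (fun=> y).

(* Classes are taken up to free homotopy: the length of a class of closed curves
   depends only on its homotopy class. *)
Definition essential_classes (Y : topologicalType) : set (set (R -> Y)) :=
  [set [set c' | closed_curve c' /\ freely_homotopic c c']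
     | c in [set c : R -> Y | closed_curve c /\ essential c]].

Local Open Scope ereal_scope.

(* Supremum over the subdivisions 0 < s_0 < ... < s_k = 1. *)
Definition curve_length (Y : Type) (d : Y -> Y -> R) (c : R -> Y) : \bar R :=
  ereal_sup [set (\sum_(0 <= n < size s)
                    d (c (nth 0%R (0%R :: s) n)) (c (nth 0%R s n)))%R%:E
            | s in itv_partition 0%R 1%R].

Definition class_length (Y : Type) (d : Y -> Y -> R) (A : set (R -> Y)) :
  \bar R := ereal_inf [set curve_length d c | c in A].

Definition lipschitz_const (X Y : Type) (dX : X -> X -> R) (dY : Y -> Y -> R)
    (phi : X -> Y) : \bar R :=
  ereal_sup [set (dY (phi xy.1) (phi xy.2) / dX xy.1 xy.2)%R%:E
            | xy in [set xy : X * X | xy.1 <> xy.2]].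

End Topology.
Arguments homotopic R {X Y} f g.
Arguments essential_classes : clear implicits.

Section RiemannSurfaces.
Context {R : realType}.
Local Notation C := (plane R).

Definition holomorphic_on (D : set C) (g : C -> C) : Prop :=
  forall z, D z -> derivable g z 1.

Record chart (X : topologicalType) := Chart {
  cdom : set X;
  cmap : X -> C;
  cinv : C -> X;
  cdom_open : open cdom;
  cimg_open : open (cmap @` cdom);
  cmapK : forall x, cdom x -> cinv (cmap x) = x;
  cmap_continuous : {within cdom, continuous cmap};
  cinv_continuous : {within cmap @` cdom, continuous cinv} }.

Record charted := Charted {
  space :> topologicalType;
  atlas : set (chart space) }.

Definition closed_riemann_surface (X : charted) : Prop :=
  [/\ forall x : X, exists2 a, atlas a & cdom a x,
      forall a b : chart X, atlas a -> atlas b ->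
        holomorphic_on (cmap a @` (cdom a `&` cdom b)) (cmap b \o cinv a),
      hausdorff_space X,
      connected [set: X]
    & compact [set: X]].

Definition holomorphic (X Y : charted) (f : X -> Y) : Prop :=
  forall (a : chart X) (b : chart Y), atlas a -> atlas b ->
    holomorphic_on (cmap a @` (cdom a `&` f @^-1` cdom b))
                   (cmap b \o f \o cinv a).

Definition conformal (X Y : charted) (k : homeo X Y) : Prop :=
  holomorphic k /\ holomorphic (hinv k).

Definition winding_number_one (c : R -> C) (w : C) : Prop :=
  exists th : R -> R,
    [/\ {within `[0, 1], continuous th},
        th 1 - th 0 = 2 * pi
      & forall t, t \in `[0, 1] ->
          c t <> w /\ c t - w = polar (modulus (c t - w)) (th t)].

(* Local degree +1 at every point: read in charts, small positively oriented
   circles around a point are mapped to curves of winding number 1 around its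
   image. *)
Definition orientation_preserving (X Y : charted) (f : X -> Y) : Prop :=
  forall (a : chart X) (b : chart Y) (x : X),
    atlas a -> atlas b -> cdom a x -> cdom b (f x) ->
    \forall r \near (0 : R)^'+,
      winding_number_one
        (fun t => cmap b (f (cinv a (cmap a x + polar r (2 * pi * t)))))
        (cmap b (f x)).

End RiemannSurfaces.
Arguments chart : clear implicits.
Arguments charted : clear implicits.

Section Tori.
Context {R : realType}.
Local Notation C := (plane R).

Record lattice := Lattice {
  omega1 : C;
  omega2 : C;
  lattice_nondeg : complex.Im (conjc omega1 * omega2) != 0 }.

Definition in_lattice (L : lattice) (z : C) : Prop :=
  exists m n : int, z = omega1 L *~ m + omega2 L *~ n.

(* area of C / L *)
Definition covolume (L : lattice) : R :=
  `|complex.Im (conjc (omega1 L) * omega2 L)|.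

Definition lattice_rel (L : lattice) : rel C :=
  fun z w => `[< in_lattice L (z - w) >].

Lemma lattice_rel_refl L : reflexive (lattice_rel L).
Proof. by move=> z; apply/asboolP; exists 0, 0; rewrite !mulr0z addr0 subrr. Qed.

Lemma lattice_rel_sym L : symmetric (lattice_rel L).
Proof.
move=> z w; apply/asboolP/asboolP => -[m [n e]]; exists (- m), (- n);
  by rewrite !mulrNz -opprD -e opprB.
Qed.

Lemma lattice_rel_trans L : transitive (lattice_rel L).
Proof.
move=> y x z /asboolP[m [n e]] /asboolP[m' [n' e']].
apply/asboolP; exists (m + m'), (n + n').
by rewrite !mulrzDr addrACA -e -e' addrA subrK.
Qed.

Definition lattice_equiv (L : lattice) : equiv_rel C :=
  EquivRel (lattice_rel L) (@lattice_rel_refl L) (@lattice_rel_sym L)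
    (@lattice_rel_trans L).

Definition torus (L : lattice) : topologicalType :=
  quotient_topology {eq_quot lattice_equiv L}.

Definition torus_proj (L : lattice) (z : C) : torus L :=
  \pi_(quotient_topology {eq_quot lattice_equiv L}) z.

Definition torus_dist (L : lattice) (x y : torus L) : R :=
  inf [set modulus (zw.1 - zw.2) | zw in
        [set zw : C * C | torus_proj L zw.1 = x /\ torus_proj L zw.2 = y]].

(* The charts of C / L are the local inverses of the projection. *)
Definition torus_surface (L : lattice) : charted R :=
  Charted [set a : chart R (torus L) |
    forall z, (cmap a @` cdom a) z -> cinv a z = torus_proj L z].

Lemma square_nondeg :
  complex.Im (conjc (1 : C) * (Complex 0 1 : C)) != 0 :> R.
Proof. by rewrite /= mulr1 mulr0 ?oppr0 ?mul0r ?addr0 oner_neq0. Qed.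

Definition T2 : charted R := torus_surface (Lattice square_nondeg).

End Tori.
Arguments lattice : clear implicits.
Arguments T2 : clear implicits.

Section Teichmuller.
Context {R : realType}.

(* Genus 1 is the existence of the marking homeomorphism. *)
Record marked_surface := MarkedSurface {
  surface :> charted R;
  surface_closed : closed_riemann_surface surface;
  marking : homeo surface (T2 R);
  marking_oriented : orientation_preserving marking }.

Definition teich_equiv (X Y : marked_surface) : Prop :=
  exists2 k : homeo X Y,
    conformal k & homotopic R (marking Y \o k) (marking X).

Record teichmuller := Teichmuller {
  representative :> marked_surface -> Prop;
  representativeP : exists X, forall Y, representative Y <-> teich_equiv X Y }.

(* d is the distance of the flat metric of area 1 that X receives from a
   conformal equivalence with a quotient of the plane. *)
Definition flat_metric (X : marked_surface) (d : X -> X -> R) : Prop :=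
  exists (L : lattice R) (u : homeo X (torus_surface L)),
    [/\ covolume L = 1, conformal u
      & forall x y, d x y = torus_dist (u x) (u y)].

Definition transport (X : marked_surface) (d : X -> X -> R) :
    T2 R -> T2 R -> R :=
  fun x y => d (hinv (marking X) x) (hinv (marking X) y).

Local Open Scope ereal_scope.

Definition kappa (X X' : marked_surface)
    (d : X -> X -> R) (d' : X' -> X' -> R) : \bar R :=
  lne (ereal_sup [set class_length (transport d') A / class_length (transport d) A
                 | A in essential_classes R (T2 R)]).

Definition lambda (X X' : marked_surface)
    (d : X -> X -> R) (d' : X' -> X' -> R) : \bar R :=
  ereal_inf [set lne (lipschitz_const d d' phi) | phi in
    [set phi : homeo X X' | lipschitz_const d d' phi < +oo /\
       homotopic R phi (hinv (marking X') \o marking X)]].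

End Teichmuller.
Arguments marked_surface : clear implicits.
Arguments teichmuller : clear implicits.

(* Main.v *)
Require Import Defs.
From mathcomp Require Import all_boot all_order all_algebra complex.
From mathcomp Require Import all_classical all_reals all_analysis.
From mathcomp Require Import ring lra.

(** In coordinates adapted to a lattice, a flat torus is the quotient of the real
plane by the integer vectors, with the distance induced by a norm on the plane
([torus_param_cover], [torus_flat_dist]).  So both surfaces are presented by
coverings [P] and [P'] of this kind, with norms [N] and [N'], and everything
is computed on lifts to the plane.

The inequality of [kappa] and [lambda] in the easy direction holds because a
map homotopic to the change of marking [g] carries each free homotopy class of
curves on the reference torus to itself, and a [k]-Lipschitz map multiplies
lengths by at most [k] ([class_length_lipschitz]).

For the converse, maps from the plane to a torus lift to the plane
([lift_exists]), and a lift [G] of the homeomorphism [g] satisfies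
[G (x + n) = G x + A n] for a linear automorphism [A] which preserves the
integer vectors ([lift_linear_part], [lift_linear_part_inv]).  The map of tori
[phi] induced by [A] is a homeomorphism, homotopic to [g] by a straight line
homotopy between the lifts ([homotopic_linear_part]).  For an integer vector
[n], the free homotopy class of the image of the segment from 0 to [n] has length
[N n] for the first metric ([segment_loop_class]) and at least [N' (A n)] for
the second one ([class_length_ge]), since the displacement between the ends of
a lifted closed curve is invariant under free homotopy.  Hence
[N' (A n) <= M * N n] with [M] the supremum of the ratios of lengths; as
rational directions are dense, this extends to all vectors
([int_linear_norm_le]), and [phi] is then [M]-Lipschitz
([int_linear_lipschitz]). *)

Set Implicit Arguments.
Unset Strict Implicit.
Unset Printing Implicit Defensive.
Import Order.TTheory GRing.Theory Num.Theory.
Import numFieldNormedType.Exports.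
Local Open Scope classical_set_scope.
Local Open Scope ring_scope.

(** * Coverings of tori by the plane and lifting *)

Lemma continuous_pair (X Y Z : topologicalType) (f : X -> Y) (g : X -> Z) x :
  {for x, continuous f} -> {for x, continuous g} ->
  {for x, continuous (fun y => (f y, g y))}.
Proof. by move=> cf cg; apply: (cvg_pair cf cg). Qed.

Lemma continuous_fst (X Y Z : topologicalType) (f : X -> Y * Z) x :
  {for x, continuous f} -> {for x, continuous (fun y => (f y).1)}.
Proof. by move=> cf; apply: continuous_comp cf _; exact: cvg_fst. Qed.

Lemma continuous_snd (X Y Z : topologicalType) (f : X -> Y * Z) x :
  {for x, continuous f} -> {for x, continuous (fun y => (f y).2)}.
Proof. by move=> cf; apply: continuous_comp cf _; exact: cvg_snd. Qed.

Section Covering.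
Context {R : realType}.
Local Notation V := ((R * R)%type : normedModType R).
Implicit Types u v w : V.

Lemma vec_ext u v : u.1 = v.1 -> u.2 = v.2 -> u = v.
Proof. by case: u v => [? ?] [? ?] /= -> ->. Qed.

Lemma vec_basis v : v = v.1 *: ((1, 0) : V) + v.2 *: ((0, 1) : V).
Proof. by apply: vec_ext; rewrite /= /GRing.scale /=; ring. Qed.

(** The lattice of integer vectors in the plane. *)
Definition int_vec (v : V) : bool :=
  (v.1 \is a Num.int) && (v.2 \is a Num.int).

Lemma int_vec0 : int_vec 0.
Proof. by rewrite /int_vec /= !rpred0. Qed.

Lemma int_vecD u v : int_vec u -> int_vec v -> int_vec (u + v).
Proof. by move=> /andP[? ?] /andP[? ?]; rewrite /int_vec /= !rpredD. Qed.

Lemma int_vecN v : int_vec (- v) = int_vec v.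
Proof. by rewrite /int_vec /= !rpredN. Qed.

Lemma int_vecB u v : int_vec u -> int_vec v -> int_vec (u - v).
Proof. by move=> ? ?; rewrite int_vecD ?int_vecN. Qed.

Lemma int_vec_lt1 v : int_vec v -> `|v| < 1 -> v = 0.
Proof.
case: v => a b /andP[/= ia ib]; rewrite prod_normE gt_max /= => /andP[a1 b1].
congr pair; apply: contraTeq isT => n0.
  by have := norm_intr_ge1 ia n0; rewrite leNgt a1.
by have := norm_intr_ge1 ib n0; rewrite leNgt b1.
Qed.

(** [P] presents [T] as the quotient of the plane by the integer vectors: this is
the universal covering of a torus, in coordinates adapted to its lattice. *)
Record torus_cover (T : topologicalType) (P : V -> T) : Prop := TorusCover {
  cover_continuous : continuous P;
  cover_open : forall U, open U -> open (P @` U);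
  cover_surj : forall y : T, exists x, P x = y;
  cover_eq : forall x y, P x = P y <-> int_vec (x - y) }.

Lemma cover_nbhs (T : topologicalType) (P : V -> T) (hP : torus_cover P) x A :
  nbhs x A -> nbhs (P x) (P @` A).
Proof.
move=> nA; have : nbhs (P x) (P @` A°).
  apply: open_nbhs_nbhs; split; last by exists x.
  by apply: cover_open => //; exact: open_interior.
by apply: filterS => _ [y Ay <-]; exists y => //; exact: interior_subset.
Qed.

Lemma cover_comp (T S : topologicalType) (P : V -> T) (f : homeo T S) :
  torus_cover P -> torus_cover (f \o P).
Proof.
move=> hP; split.
- move=> x; apply: continuous_comp; first exact: cover_continuous.
  exact: hfun_continuous.
- move=> U oU; rewrite (_ : _ @` U = hinv f @^-1` (P @` U)).
    apply: open_comp; last exact: cover_open.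
    by move=> ? _; exact: hinv_continuous.
  apply/seteqP; split => [_ [x Ux <-]|y [x Ux xy]].
    by exists x; rewrite //= hfunK.
  by exists x; rewrite //= xy hinvK.
- move=> y; have [x xy] := cover_surj hP (hinv f y).
  by exists x; rewrite /= xy hinvK.
- move=> x y; rewrite -(cover_eq hP) /=; split=> [/(congr1 (hinv f))|->//].
  by rewrite !hfunK.
Qed.

(** The increment from [p] to [q] is the vector of sup norm less than 1/2 which
translates some lift of [p] to a lift of [q]; such a vector is unique if it
exists, and the increment is 0 if there is none. *)
Definition increment (T : topologicalType) (P : V -> T) (p q : T) : V :=
  xget 0 [set v | `|v| < 1 / 2 /\ exists2 a, P a = p & P (a + v) = q].

Lemma incrementE (T : topologicalType) (P : V -> T) (hP : torus_cover P) a v :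
  `|v| < 1 / 2 -> increment P (P a) (P (a + v)) = v.
Proof.
move=> v2; rewrite /increment; case: xgetP => [w _ [w2 [b ba bw]]|H].
  have i1 : int_vec (b - a) by apply/(cover_eq hP).
  have i2 : int_vec ((b + w) - (a + v)) by apply/(cover_eq hP).
  have : int_vec (w - v).
    have -> : w - v = ((b + w) - (a + v)) - (b - a).
      by apply: vec_ext => /=; ring.
    exact: int_vecB.
  move=> /int_vec_lt1 /(_ _)/eqP; rewrite subr_eq0 => wv; apply/eqP/wv.
  by apply: le_lt_trans (ler_normB _ _) _; lra.
by exfalso; apply: (H v); split=> //; exists a.
Qed.

Lemma increment_continuous (T : topologicalType) (P : V -> T)
    (hP : torus_cover P) a v : `|v| < 1 / 2 ->
  {for (P a, P (a + v)), continuous (fun pq => increment P pq.1 pq.2)}.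
Proof.
move=> v2 W; rewrite /= incrementE // => nW.
have [[A B] [/= nA nB] AB] : nbhs (a, a + v)
    [set z : V * V | W (z.2 - z.1) /\ `|z.2 - z.1| < 1 / 2].
  have c : (fun z : V * V => z.2 - z.1) @ (a, a + v) --> v.
    rewrite -[X in _ --> X](addrK a v) [v + a]addrC.
    by apply: (@cvgB R V _ _ _ snd fst); [exact: cvg_snd | exact: cvg_fst].
  near=> z; split; near: z; first exact: (c _ nW).
  exact: (cvgr_norm_lt v).
exists (P @` A, P @` B); first by split; exact: cover_nbhs.
move=> [_ _] [/= [a' Aa' <-] [b' Bb' <-]]; have [/= h1 h2] := AB (a', b') (conj Aa' Bb').
by rewrite -(addrNK a' b') [b' - a' + a']addrC incrementE.
Unshelve. all: by end_near. Qed.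

(** The pairs of points which are joined by a vector of sup norm less than 1/2. *)
Definition close (T : topologicalType) (P : V -> T) : set (T * T) :=
  [set pq | exists a v, [/\ `|v| < 1 / 2, P a = pq.1 & P (a + v) = pq.2]].

Lemma nbhs_close (T : topologicalType) (P : V -> T) (hP : torus_cover P) (p : T) :
  nbhs (p, p) (close P).
Proof.
have [a <-] := cover_surj hP p.
have [[A B] [/= nA nB] AB] : nbhs (a, a) [set z : V * V | `|z.2 - z.1| < 1 / 2].
  have c : (fun z : V * V => z.2 - z.1) @ (a, a) --> a - a.
    by apply: (@cvgB R V _ _ _ snd fst); [exact: cvg_snd | exact: cvg_fst].
  near=> z; rewrite /=; near: z; apply: (cvgr_norm_lt (a - a) c).
  by rewrite subrr normr0.
exists (P @` A, P @` B); first by split; exact: cover_nbhs.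
move=> [_ _] [/= [a' Aa' <-] [b' Bb' <-]]; exists a', (b' - a').
by rewrite [a' + _]addrC addrNK; split => //; exact: (AB (a', b')).
Unshelve. all: by end_near. Qed.

(** A Lebesgue number argument: along a compact family of paths, consecutive
points of a fine enough subdivision of [0, 1] are related by any given
neighbourhood [E] of the diagonal. *)
Lemma fine_subdivision (W T : topologicalType) (K : set W) (f : R * W -> T)
    (E : set (T * T)) : compact K -> continuous f ->
    (forall p : T, nbhs (p, p) E) ->
  exists N, forall x, K x -> forall j, (j < N.+1)%N ->
    E (f (j%:R / N.+1%:R, x), f (j.+1%:R / N.+1%:R, x)).
Proof.
move=> cK cf nE.
have cIK : compact (`[0 : R, 1] `*` K).
  by apply: compact_setX => //; exact: segment_compact.
move/compact_near_coveringP : cIK => /(_ nat \oo (fun N (tx : R * W) =>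
   E (f tx, f (tx.1 + N.+1%:R^-1, tx.2))) _) [].
  move=> [t x] _ /=.
  have cg : {for ((t, x), 0), continuous (fun z : (R * W) * R =>
      (f z.1, f (z.1.1 + z.2, z.1.2)))}.
    apply: continuous_pair.
      by apply: continuous_comp; [exact: continuous_fst | exact: cf].
    apply: (@continuous_comp _ _ _ (fun z : (R * W) * R => (z.1.1 + z.2, z.1.2)) f);
      last exact: cf.
    apply: continuous_pair; last by apply: continuous_snd; exact: continuous_fst.
    apply: cvgD; last exact: continuous_snd.
    by apply: continuous_fst; exact: continuous_fst.
  have [[A B] [/= nA nB] AB] : nbhs ((t, x), 0)
      [set z : (R * W) * R | E (f z.1, f (z.1.1 + z.2, z.1.2))].
    by apply: cg; rewrite /= addr0.
  have /nbhs_ballP[e /= e0 eB] := nB.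
  exists (A, [set N | N.+1%:R^-1 < e]); first split=> //=.
    exact: (near_infty_natSinv_lt (PosNum e0)).
  move=> [[t' x'] N] [/= At' Ne]; apply: (AB ((t', x'), N.+1%:R^-1)); split=> //=.
  by apply: eB; rewrite -ball_normE /= sub0r normrN ger0_norm ?invr_ge0.
move=> N _ /(_ N (leqnn N)) H; exists N => x Kx j jN.
have := H (j%:R / N.+1%:R, x).
rewrite /= -[X in _ + X]mul1r -mulrDl natr1; apply; split=> //=.
by rewrite in_itv /= divr_ge0 //= ler_pdivrMr ?ltr0Sn // mul1r ler_nat ltnW.
Qed.

Lemma integer_valued_const (f : R -> V) : {within `[0, 1], continuous f} ->
  (forall t, t \in `[0, 1] -> int_vec (f t)) -> f 0 = f 1.
Proof.
move=> cf fi.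
have key (g : R -> R) : {within `[0, 1], continuous g} ->
    (forall t, t \in `[0, 1] -> g t \is a Num.int) -> g 0 = g 1.
  move=> cg gi; apply: contraTeq isT => /= g01.
  pose m := Num.min (g 0) (g 1).
  have m01 : m \is a Num.int.
    by rewrite /m; case: (leP (g 0) (g 1)) => _; apply: gi; rewrite in_itv /= lexx ler01.
  have mM : m + 1 / 2 <= Num.max (g 0) (g 1).
    have := norm_intr_ge1 (rpredB (gi 0 _) (gi 1 _)).
    rewrite !in_itv /= !lexx !ler01 subr_eq0 g01 /= => /(_ isT isT isT).
    rewrite /m; case: (ltgtP (g 0) (g 1)) (g01) => // h _.
      by rewrite ltr0_norm ?subr_lt0 //; lra.
    by rewrite gtr0_norm ?subr_gt0 //; lra.
  (* [m + 1 / 2] would be an integer value of [g]. *)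
  have [|c c01 gc] := @IVT R g 0 1 (m + 1 / 2) ler01 cg.
    by rewrite mM andbT -/m; lra.
  have := norm_intr_ge1 (rpredB (gi c c01) m01).
  by rewrite gc [m + _]addrC addrK => /(_ _); rewrite ger0_norm; lra.
have c1 : {within `[0, 1], continuous (fst \o f)}.
  by move=> x; exact: (continuous_fst (cf x)).
have c2 : {within `[0, 1], continuous (snd \o f)}.
  by move=> x; exact: (continuous_snd (cf x)).
rewrite [LHS]surjective_pairing [RHS]surjective_pairing; congr pair.
- by apply: (key _ c1) => t /fi/andP[].
- by apply: (key _ c2) => t /fi/andP[].
Qed.

(** Two lifts of the same path differ by an integer vector, which is constant by
connectedness. *)
Lemma lift_displacement (T : topologicalType) (P : V -> T)
    (hP : torus_cover P) (k l : R -> V) :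
  {within `[0, 1], continuous k} -> {within `[0, 1], continuous l} ->
  (forall t, t \in `[0, 1] -> P (k t) = P (l t)) -> k 1 - k 0 = l 1 - l 0.
Proof.
move=> ck cl kl; have e : k 0 - l 0 = k 1 - l 1.
  apply: (@integer_valued_const (k \- l)); first exact: within_continuousB.
  by move=> t /kl; rewrite (cover_eq hP).
by apply: vec_ext; [move: (congr1 fst e) | move: (congr1 snd e)] => /=; lra.
Qed.

(** On a ball, the lift at [p] is the sum of the increments of [f] along a fine
subdivision of the segment from 0 to [p].  The subdivision is uniform on the
ball, so this is a finite sum of continuous functions. *)
Lemma lift_on_ball (T : topologicalType) (P : V -> T) (hP : torus_cover P)
    (f : V -> T) (z : V) (r : R) : continuous f -> P z = f 0 ->
  exists2 F : V -> V, F 0 = z & forall p, `|p| < r ->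
    {for p, continuous F} /\ P (F p) = f p.
Proof.
move=> cf zf.
have cK : compact (`[- r, r] `*` `[- r, r]).
  by apply: compact_setX; exact: segment_compact.
have cfs : continuous (fun tp : R * V => f (tp.1 *: tp.2)).
  move=> [t p]; apply: (@continuous_comp _ _ _ (fun tp : R * V => tp.1 *: tp.2) f);
    last exact: cf.
  by apply: scale_continuous.
have [N HN] := fine_subdivision cK cfs (nbhs_close hP).
pose inc j p := increment P (f ((j%:R / N.+1%:R) *: p))
                            (f ((j.+1%:R / N.+1%:R) *: p)).
pose F m p := z + \sum_(j < m) inc j p.
have inball p : `|p| < r -> (`[- r, r] `*` `[- r, r]) p.
  rewrite prod_normE gt_max => /andP[p1 p2]; split; rewrite /= in_itv /= -ler_norml ltW //.
exists (F N.+1) => [|p pr].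
  rewrite /F big1 ?addr0 // => j _; rewrite /inc !scaler0.
  have [a <-] := cover_surj hP (f 0).
  by rewrite -{2}[a]addr0 incrementE // normr0; lra.
have step j : (j < N.+1)%N -> exists a v, [/\ `|v| < 1 / 2,
   P a = f ((j%:R / N.+1%:R) *: p) & P (a + v) = f ((j.+1%:R / N.+1%:R) *: p)].
  by move=> jN; exact: HN (inball _ pr) _ jN.
split.
  have Fc m : (m <= N.+1)%N -> {for p, continuous (F m)}.
    elim: m => [_|m IH mN].
      have -> : F 0%N = cst z by apply/funext => q; rewrite /F big_ord0 addr0.
      exact: cst_continuous.
    have -> : F m.+1 = F m + inc m.
      by apply/funext => q; rewrite /F big_ord_recr /= addrA.
    apply: continuousD; first exact: (IH (ltnW mN)).
    have [a [v [v2 Pa Pav]]] := step m mN.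
    have fc j : {for p, continuous (fun q : V => f ((j%:R / N.+1%:R) *: q))}.
      apply: (@continuous_comp _ _ _ (fun q : V => (j%:R / N.+1%:R) *: q) f);
        last exact: cf.
      by apply: cvgZl_tmp; exact: cvg_id.
    apply: (@continuous_comp _ _ _
      (fun q => (f ((m%:R / N.+1%:R) *: q), f ((m.+1%:R / N.+1%:R) *: q)))
      (fun pq => increment P pq.1 pq.2)); first exact: continuous_pair.
    by rewrite -Pa -Pav; exact: increment_continuous.
  exact: Fc.
suff H m : (m <= N.+1)%N -> P (F m p) = f ((m%:R / N.+1%:R) *: p).
  by rewrite H // divff ?pnatr_eq0 // scale1r.
elim: m => [_|m IH mN]; first by rewrite /F big_ord0 addr0 mul0r scale0r.
have [a [v [v2 Pa Pav]]] := step m mN.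
rewrite /F big_ord_recr /= addrA -/(F m p) /inc -Pa -Pav incrementE //.
have /(cover_eq hP) : P (F m p) = P a by rewrite IH 1?ltnW // Pa.
move=> i1; apply/(cover_eq hP).
by have -> : F m p + v - (a + v) = F m p - a by apply: vec_ext => /=; lra.
Qed.

(** The lifts on the balls agree by uniqueness along rays, hence glue. *)
Lemma lift_exists (T : topologicalType) (P : V -> T) (hP : torus_cover P)
    (f : V -> T) : continuous f ->
  exists2 F : V -> V, continuous F & forall p, P (F p) = f p.
Proof.
move=> cf; have [z zf] := cover_surj hP (f 0).
have /choice[F HF] : forall n : nat, exists F : V -> V, F 0 = z /\
    forall p, `|p| < n%:R -> {for p, continuous F} /\ P (F p) = f p.
  by move=> n; have [F F0 HF] := lift_on_ball hP n%:R cf zf; exists F.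
have agree m n p : `|p| < m%:R -> `|p| < n%:R -> F m p = F n p.
  move=> pm pn; have sub t : t \in `[0, 1] -> `|t *: p| <= `|p|.
    rewrite in_itv /= => /andP[t0 t1].
    by rewrite normrZ ger0_norm // ler_piMl.
  have ray q : `|p| < q%:R -> {within `[0, 1], continuous (fun t : R => F q (t *: p))}.
    move=> pq; apply/subspace_continuousP => t t01.
    apply: cvg_within_filter; apply: (@continuous_comp _ _ _ (fun t : R => t *: p) (F q)).
      by apply: cvgZr_tmp; exact: cvg_id.
    by have [] := (HF q).2 (t *: p) (le_lt_trans (sub t t01) pq).
  have := lift_displacement hP (ray m pm) (ray n pn) _.
  rewrite !scale1r !scale0r !(HF _).1 => /(_ _)/addIr; apply => t t01.
  by rewrite ((HF m).2 _ _).2 ?((HF n).2 _ _).2 //; apply: le_lt_trans (sub t t01) _.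
(* any integer above the norm of p *)
pose b (p : V) := Num.Def.archi_bound `|p|.
have bP p : `|p| < (b p)%:R by apply: archi_boundP.
exists (fun p => F (b p) p) => p; last by have [_ ->] := (HF _).2 p (bP p).
have [Fp _] := (HF (b p)).2 p (bP p).
apply: cvg_trans Fp; apply: near_eq_cvg; near=> q.
apply: agree; last exact: bP.
near: q; exact: (cvgr_norm_lt p cvg_id _ (bP p)).
Unshelve. all: end_near. Qed.

End Covering.

(** * Norms on the plane, distances on tori and lengths of curves *)

Section FlatMetric.
Context {R : realType}.
Local Notation V := ((R * R)%type : normedModType R).
Implicit Types u v w : V.

(** A norm on the plane, compared with the sup norm from below. *)
Record plane_norm (N : V -> R) : Prop := PlaneNorm {
  plane_normD : forall u v, N (u + v) <= N u + N v;
  plane_normZ : forall (t : R) v, N (t *: v) = `|t| * N v;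
  plane_norm_coercive : exists2 c, 0 < c & forall v, c * `|v| <= N v }.

Section Norm.
Variables (N : V -> R) (hN : plane_norm N).

Lemma plane_norm0 : N 0 = 0.
Proof. by rewrite -(scale0r 0) (plane_normZ hN) normr0 mul0r. Qed.

Lemma plane_norm_ge0 v : 0 <= N v.
Proof.
have [c c0 /(_ v)] := plane_norm_coercive hN; apply: le_trans.
by rewrite mulr_ge0 // ltW.
Qed.

Lemma plane_normN v : N (- v) = N v.
Proof. by rewrite -scaleN1r (plane_normZ hN) normrN normr1 mul1r. Qed.

Lemma plane_norm_eq0 v : N v = 0 -> v = 0.
Proof.
have [c c0 cN] := plane_norm_coercive hN => v0; apply/eqP.
rewrite -normr_le0; have := cN v; rewrite v0 => h.
by rewrite -(@pmulr_rle0 _ c).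
Qed.

Lemma plane_norm_sum (I : Type) (r : seq I) (F : I -> V) :
  N (\sum_(i <- r) F i) <= \sum_(i <- r) N (F i).
Proof.
elim/big_rec2: _ => [|i y x _ h]; first by rewrite plane_norm0.
by apply: le_trans (plane_normD hN _ _) _; rewrite lerD2l.
Qed.

Lemma plane_norm_bound : exists2 C, 0 < C & forall v, N v <= C * `|v|.
Proof.
exists (N (1, 0) + N (0, 1) + 1).
  by have := plane_norm_ge0 (1, 0); have := plane_norm_ge0 (0, 1); lra.
move=> v; rewrite {1}(vec_basis v); apply: le_trans (plane_normD hN _ _) _.
rewrite !(plane_normZ hN).
have v1 : `|v.1| <= `|v| by rewrite [leRHS]prod_normE le_max lexx.
have v2 : `|v.2| <= `|v| by rewrite [leRHS]prod_normE le_max lexx orbT.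
have := plane_norm_ge0 (1, 0); have := plane_norm_ge0 (0, 1); have := normr_ge0 v; nra.
Qed.

Lemma plane_norm_continuous : continuous N.
Proof.
move=> v; have [C C0 CN] := plane_norm_bound.
apply/cvgrPdist_lt => e e0; near=> w.
have lip : `|N v - N w| <= N (v - w).
  have h1 := plane_normD hN (v - w) w; rewrite subrK in h1.
  have h2 := plane_normD hN (w - v) v; rewrite subrK -[w - v]opprB plane_normN in h2.
  by rewrite ler_norml; lra.
apply: (le_lt_trans lip); apply: (le_lt_trans (CN _)).
rewrite mulrC -ltr_pdivlMr //; near: w.
by apply: cvgr_dist_lt; [exact: cvg_id | rewrite divr_gt0].
Unshelve. all: end_near. Qed.

End Norm.

(** [d] is the distance on the torus induced by the norm [N] of the plane. *)
Definition flat_dist (T : topologicalType) (P : V -> T) (N : V -> R)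
    (d : T -> T -> R) : Prop :=
  forall a b, d (P a) (P b) = inf [set N (a - b + n) | n in [set n | int_vec n]].

Section Distance.
Variables (T : topologicalType) (P : V -> T) (N : V -> R) (d : T -> T -> R).
Hypotheses (hP : torus_cover P) (hN : plane_norm N) (hd : flat_dist P N d).

Lemma flat_dist_le a b n : int_vec n -> d (P a) (P b) <= N (a - b + n).
Proof.
move=> n0; rewrite hd; apply: ge_inf; last by exists n.
by exists 0 => _ [m _ <-]; exact: plane_norm_ge0.
Qed.

Lemma flat_dist_ge a b m : (forall n, int_vec n -> m <= N (a - b + n)) ->
  m <= d (P a) (P b).
Proof.
move=> H; rewrite hd; apply: lb_le_inf; last by move=> _ [n /H ? <-].
by exists (N (a - b + 0)); exists 0 => //; exact: int_vec0.
Qed.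

Lemma flat_dist_ge0 p q : 0 <= d p q.
Proof.
have [[a <-] [b <-]] := (cover_surj hP p, cover_surj hP q).
by apply: flat_dist_ge => n _; exact: plane_norm_ge0.
Qed.

Lemma flat_distxx p : d p p = 0.
Proof.
have [a <-] := cover_surj hP p; apply/eqP; rewrite eq_le flat_dist_ge0 andbT.
by have := flat_dist_le a a int_vec0; rewrite subrr addr0 plane_norm0.
Qed.

Lemma dist_int_gt0 (t : R) : t \isn't a Num.int ->
  exists2 e, 0 < e & forall n, n \is a Num.int -> e <= `|t + n|.
Proof.
move=> nt; have l1 := floor_le_tmp t; have l2 := floorD1_gt t.
have tf : (Num.floor t)%:~R != t.
  by apply: contra nt => /eqP <-; exact: intr_int.
exists (Num.min (t - (Num.floor t)%:~R) ((Num.floor t + 1)%:~R - t)).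
  by rewrite lt_min !subr_gt0 l2 andbT lt_neqAle tf l1.
move=> _ /intrP[m ->]; rewrite ge_min.
case: (lerP (- m) (Num.floor t)) => h; apply/orP; [left|right].
  have : (- m)%:~R <= (Num.floor t)%:~R :> R by rewrite ler_int.
  by rewrite mulrNz => h'; rewrite ger0_norm; lra.
rewrite -lezD1 in h; have : (Num.floor t + 1)%:~R <= (- m)%:~R :> R by rewrite ler_int.
by rewrite mulrNz => h'; rewrite ler0_norm; lra.
Qed.

(** The distance separates points because the distance from a non-integral
vector to the integer vectors is positive. *)
Lemma flat_dist_gt0 p q : p <> q -> 0 < d p q.
Proof.
have [[a <-] [b <-]] := (cover_surj hP p, cover_surj hP q).
move=> pq; have [c c0 cN] := plane_norm_coercive hN.
have : ~~ int_vec (a - b) by apply/negP => /(cover_eq hP).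
rewrite negb_and => /orP[] /dist_int_gt0[e e0 eH].
  apply: (@lt_le_trans _ _ (c * e)); first exact: mulr_gt0.
  apply: flat_dist_ge => n /andP[/eH n1 _]; apply: le_trans (cN _).
  rewrite ler_pM2l //; apply: le_trans n1 _.
  by rewrite [leRHS]prod_normE le_max lexx.
apply: (@lt_le_trans _ _ (c * e)); first exact: mulr_gt0.
apply: flat_dist_ge => n /andP[_ /eH n1]; apply: le_trans (cN _).
rewrite ler_pM2l //; apply: le_trans n1 _.
by rewrite [leRHS]prod_normE le_max lexx orbT.
Qed.

(** The covering is isometric at small scale. *)
Lemma flat_dist_local : exists2 r, 0 < r &
  forall a b, N (a - b) < r -> d (P a) (P b) = N (a - b).
Proof.
have [c c0 cN] := plane_norm_coercive hN.
exists (c / 2) => [|a b ab]; first by rewrite divr_gt0.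
apply/eqP; rewrite eq_le; apply/andP; split.
  by rewrite -[leRHS](congr1 N (addr0 (a - b))); apply: flat_dist_le; exact: int_vec0.
apply: flat_dist_ge => n ni.
have [->|n0] := eqVneq n 0; first by rewrite addr0.
have n1 : 1 <= `|n|.
  by rewrite leNgt; apply: contra n0 => /(int_vec_lt1 ni) ->.
have h := plane_normD hN (a - b + n) (- (a - b)).
rewrite addrAC subrr add0r plane_normN // in h.
have := cN n; nra.
Qed.

(** A curve is at least as long as the displacement of any of its lifts: on a
fine subdivision the distances are the norms of the increments of the lift. *)
Lemma curve_length_ge (k : R -> V) (c : R -> T) : continuous k ->
  (forall t, t \in `[0, 1] -> P (k t) = c t) ->
  ((N (k 1 - k 0))%:E <= curve_length d c)%E.
Proof.
move=> ck kc; have [r r0 rH] := flat_dist_local.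
have [||p|M HM] := @fine_subdivision R R V [set 0] (fun tx => k tx.1)
    [set pq | N (pq.1 - pq.2) < r].
- exact: compact_set1.
- by move=> tx; apply: continuous_comp; [exact: cvg_fst | exact: ck].
- have cs : {for (p, p), continuous (fun pq : V * V => N (pq.1 - pq.2))}.
    apply: continuous_comp; last exact: plane_norm_continuous.
    by apply: (@cvgB R V _ _ _ fst snd); [exact: cvg_fst | exact: cvg_snd].
  have /cs : nbhs (N (p - p)) [set t | t < r].
    by apply: lt_nbhsl; rewrite subrr plane_norm0.
  exact.
pose x j : R := j%:R / M.+1%:R.
pose s := mkseq (fun j => x j.+1) M.+1.
have ss : size s = M.+1 by rewrite size_mkseq.
have ns j : (j < M.+1)%N -> nth 0 s j = x j.+1 by move=> ?; rewrite nth_mkseq.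
have ns0 j : (j < M.+1)%N -> nth 0 (0 :: s) j = x j.
  case: j => [_|j jM] /=; first by rewrite /x mul0r.
  by rewrite ns // ltnW.
have ps : itv_partition 0 1 s.
  split; last by rewrite -nth_last ss /= ns // /x divff // pnatr_eq0.
  apply/(pathP 0) => j; rewrite ss => jM; rewrite ns // ns0 //.
  by rewrite ltr_pM2r ?invr_gt0 ?ltr0Sn // ltr_nat.
apply: le_trans (ereal_sup_ubound _); last by exists s; first exact: ps.
rewrite lee_fin ss big_mkord.
have -> : k 1 - k 0 = - \sum_(j < M.+1) (k (x j) - k (x j.+1)).
  rewrite -(big_mkord xpredT (fun j => k (x j) - k (x j.+1))).
  rewrite (eq_bigr (fun j => - (k (x j.+1) - k (x j)))); last by move=> j _; rewrite opprB.
  rewrite sumrN opprK telescope_sumr // /x divff ?pnatr_eq0 //.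
  by rewrite mul0r.
rewrite plane_normN //; apply: le_trans (plane_norm_sum hN _ _) _.
apply: ler_sum => j _; rewrite ns0 // ns //.
have x01 i : (i <= M.+1)%N -> x i \in `[0, 1].
  move=> iM; rewrite in_itv /= divr_ge0 //=.
  by rewrite ler_pdivrMr ?ltr0Sn // mul1r ler_nat.
rewrite -!kc ?x01 // 1?ltnW // rH //.
exact: (HM 0 erefl).
Qed.

Lemma curve_length_segment (v : V) :
  (curve_length d (fun t => P (t *: v)) <= (N v)%:E)%E.
Proof.
apply: ge_ereal_sup => _ [s [ps /eqP ls] <-]; rewrite lee_fin.
pose x j := nth 0 (0 :: s) j.
apply: (@le_trans _ _ (\sum_(0 <= j < size s) (x j.+1 - x j) * N v)).
  apply: ler_sum_nat => j /andP[_ js].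
  have := flat_dist_le (x j *: v) (x j.+1 *: v) int_vec0.
  rewrite addr0 -scalerBl plane_normZ // distrC ger0_norm // subr_ge0 ltW //.
  by move/(pathP 0) : ps => /(_ j js).
rewrite -mulr_suml telescope_sumr // /x /= subr0.
by rewrite -(last_nth 0) ls mul1r.
Qed.

End Distance.
End FlatMetric.

(** * Linear parts of maps between tori *)

Section Linear.
Context {R : realType}.
Local Notation V := ((R * R)%type : normedModType R).
Implicit Types u v w : V.

(** Linear endomorphisms of the plane which preserve the integer vectors. *)
Record int_linear (A : V -> V) : Prop := IntLinear {
  int_linearD : forall u v, A (u + v) = A u + A v;
  int_linearZ : forall (t : R) v, A (t *: v) = t *: A v;
  int_linear_int : forall n, int_vec n -> int_vec (A n);
  int_linear_continuous : continuous A }.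

Lemma int_linear0 A : int_linear A -> A 0 = 0.
Proof. by move=> hA; have := int_linearZ hA 0 0; rewrite !scale0r. Qed.

Lemma int_linearB A u v : int_linear A -> A (u - v) = A u - A v.
Proof.
by move=> hA; rewrite (int_linearD hA) -[- v]scaleN1r (int_linearZ hA) scaleN1r.
Qed.

Lemma int_vecE (n : V) : int_vec n ->
  exists i j : int, n = i%:~R *: ((1, 0) : V) + j%:~R *: ((0, 1) : V).
Proof.
move=> /andP[/intrP[i ni] /intrP[j nj]]; exists i, j.
by rewrite [LHS]vec_basis ni nj.
Qed.

Lemma int_vec_basis1 : int_vec ((1, 0) : V).
Proof. by rewrite /int_vec /= rpred0 rpred1. Qed.

Lemma int_vec_basis2 : int_vec ((0, 1) : V).
Proof. by rewrite /int_vec /= rpred0 rpred1. Qed.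

Lemma int_vecZ (i : int) (n : V) : int_vec n -> int_vec (i%:~R *: n).
Proof.
by move=> /andP[n1 n2]; apply/andP; split => /=; apply: rpredM => //; exact: intr_int.
Qed.

(** An additive function on integer vectors extends to a linear map. *)
Lemma int_additive_linear (D : V -> V) :
  (forall m n, int_vec m -> int_vec n -> D (m + n) = D m + D n) ->
  (forall n, int_vec n -> int_vec (D n)) ->
  exists2 A, int_linear A & forall n, int_vec n -> A n = D n.
Proof.
move=> DD Di.
have D0 : D 0 = 0.
  by have := DD 0 0 int_vec0 int_vec0; rewrite addr0 -{1}[D 0]addr0 => /addrI <-.
have DN (n : V) : int_vec n -> D (- n) = - D n.
  move=> ni; apply/eqP; rewrite -addr_eq0 -DD ?int_vecN //.
  by rewrite addrC subrr D0.
have DZ (i : int) (n : V) : int_vec n -> D (i%:~R *: n) = i%:~R *: D n.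
  move=> ni; elim: i => [|i IH|i IH]; first by rewrite !scale0r.
    by rewrite intS intrD !scalerDl !scale1r DD ?IH //; exact: int_vecZ.
  rewrite intS opprD intrD !scalerDl mulrN1z !scaleN1r DD ?IH ?DN //.
    by rewrite int_vecN.
  exact: int_vecZ.
pose a := D (1, 0); pose b := D (0, 1).
exists (fun v => v.1 *: a + v.2 *: b); last first.
  move=> n /int_vecE[i [j ->]].
  rewrite DD; try (by apply: int_vecZ; rewrite ?int_vec_basis1 ?int_vec_basis2).
  rewrite !DZ ?int_vec_basis1 ?int_vec_basis2 //.
  by congr (_ *: _ + _ *: _); rewrite /= /GRing.scale /=; ring.
split.
- by move=> u v; rewrite /= !scalerDl addrACA.
- by move=> t v; rewrite /= scalerDr !scalerA.
- move=> n /int_vecE[i [j ->]]; rewrite /=.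
  rewrite /GRing.scale /= !mulr0 !mulr1 addr0 add0r.
  by apply: int_vecD; apply: int_vecZ; apply: Di;
    [exact: int_vec_basis1 | exact: int_vec_basis2].
- move=> v; apply: cvgD; apply: cvgZr_tmp; [exact: cvg_fst | exact: cvg_snd].
Qed.

(** Continuity on [0, 1] of a path defined on the whole line. *)
Lemma path_within (k : R -> V) : continuous k -> {within `[0, 1], continuous k}.
Proof. exact: continuous_subspaceT. Qed.

(** The action on fundamental groups of a map between tori, seen as a linear map
of the universal covers. *)
Lemma lift_linear_part (T T' : topologicalType) (P : V -> T) (P' : V -> T')
    (g : T -> T') (G : V -> V) :
  torus_cover P -> torus_cover P' -> continuous G ->
  (forall p, P' (G p) = g (P p)) ->
  exists2 A, int_linear A & forall p n, int_vec n -> G (p + n) = G p + A n.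
Proof.
move=> hP hP' cG Gg.
have per p (n : V) : int_vec n -> P (p + n) = P p.
  by move=> ni; apply/(cover_eq hP); rewrite addrAC subrr add0r.
have key p n : int_vec n -> G (p + n) = G p + (G n - G 0).
  move=> ni.
  have c1 : continuous (fun t : R => G (t *: p + n)).
    move=> t; apply: (@continuous_comp _ _ _ (fun t : R => t *: p + n) G);
      last exact: cG.
    by apply: cvgD; [apply: cvgZr_tmp; exact: cvg_id | exact: cvg_cst].
  have c2 : continuous (fun t : R => G (t *: p)).
    move=> t; apply: (@continuous_comp _ _ _ (fun t : R => t *: p) G);
      last exact: cG.
    by apply: cvgZr_tmp; exact: cvg_id.
  have := lift_displacement hP' (path_within c1) (path_within c2) _.
  rewrite !scale1r !scale0r add0r => /(_ _) e.
  have {}e := e (fun t _ => etrans (Gg _) (etrans (congr1 g (per _ _ ni)) (esym (Gg _)))).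
  by apply: vec_ext; [move: (congr1 fst e) | move: (congr1 snd e)] => /=; lra.
have [m n mi ni|n ni|A hA AD] := @int_additive_linear (fun n => G n - G 0).
- by rewrite key // addrAC.
- by apply/(cover_eq hP'); rewrite !Gg -[n]add0r per.
- by exists A => // p n ni; rewrite AD // key.
Qed.

(** Inverse homeomorphisms have inverse linear parts. *)
Lemma lift_linear_part_inv (T T' : topologicalType) (P : V -> T) (P' : V -> T')
    (g : T -> T') (h : T' -> T) (G H A B : V -> V) :
  torus_cover P -> torus_cover P' -> cancel g h ->
  continuous G -> continuous H ->
  (forall p, P' (G p) = g (P p)) -> (forall p, P (H p) = h (P' p)) ->
  int_linear A -> int_linear B ->
  (forall p n, int_vec n -> G (p + n) = G p + A n) ->
  (forall p n, int_vec n -> H (p + n) = H p + B n) -> cancel A B.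
Proof.
move=> hP hP' gK cG cH Gg Hh hA hB GA HB.
have key (n : V) : int_vec n -> B (A n) = n.
  move=> ni.
  have c2 : continuous (fun t : R => t *: n).
    by move=> t; apply: cvgZr_tmp; exact: cvg_id.
  have c1 : continuous (fun t : R => H (G (t *: n))).
    move=> t; apply: (@continuous_comp _ _ _ (fun t : R => G (t *: n)) H);
      last exact: cH.
    by apply: (@continuous_comp _ _ _ (fun t : R => t *: n) G); [exact: c2 | exact: cG].
  have := lift_displacement hP (path_within c1) (path_within c2) _.
  rewrite !scale1r !scale0r subr0 => /(_ _) e.
  rewrite -[RHS]e => [|t _]; last by rewrite Hh Gg gK.
  rewrite -{2}[n]add0r GA // HB; last exact: int_linear_int.
  by rewrite addrAC subrr add0r.
move=> v; rewrite [v]vec_basis !(int_linearD hA, int_linearZ hA).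
by rewrite !(int_linearD hB, int_linearZ hB) !key ?int_vec_basis1 ?int_vec_basis2.
Qed.
End Linear.

(** * Affine maps, and free homotopies of closed curves *)

Section Affine.
Context {R : realType}.
Local Notation V := ((R * R)%type : normedModType R).
Implicit Types u v w : V.

Lemma cover_quotient (T S : topologicalType) (P : V -> T) (f : T -> S) :
  torus_cover P -> continuous (f \o P) -> continuous f.
Proof.
move=> hP cf p; have [x <-] := cover_surj hP p.
move=> W nW; have := cover_nbhs hP (cf x W nW).
by apply: filterS => _ [y Wy <-].
Qed.

(** As [P] is open, its product with the identity of [W] is a quotient map. *)
Lemma cover_quotient_prod (W T S : topologicalType) (P : V -> T)
    (f : W * T -> S) : torus_cover P ->
  continuous (fun wx : W * V => f (wx.1, P wx.2)) -> continuous f.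
Proof.
move=> hP cf [w p]; have [x <-] := cover_surj hP p.
move=> Z nZ; have [[A B] /= [nA nB] AB] := cf (w, x) Z nZ.
exists (A, P @` B); first by split=> //; exact: cover_nbhs.
by move=> [w' _] /= [Aw' [y By <-]]; exact: (AB (w', y)).
Qed.

Lemma cover_section (T : topologicalType) (P : V -> T) : torus_cover P ->
  exists s, cancel s P.
Proof. by move=> hP; have [s sK] := choice (cover_surj hP); exists s. Qed.

Lemma int_linear_descends (T T' : topologicalType) (P : V -> T) (P' : V -> T')
    (A : V -> V) : torus_cover P -> torus_cover P' -> int_linear A ->
  exists2 f : T -> T', continuous f & forall x, f (P x) = P' (A x).
Proof.
move=> hP hP' hA; have [s sK] := cover_section hP.
have fP x : P' (A (s (P x))) = P' (A x).
  apply/(cover_eq hP'); rewrite -int_linearB //; apply: int_linear_int => //.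
  by apply/(cover_eq hP).
exists (fun p => P' (A (s p))) => //.
apply: (cover_quotient hP) => x.
have -> : (fun p => P' (A (s p))) \o P = P' \o A by apply/funext => y /=; rewrite fP.
by apply: continuous_comp; [exact: int_linear_continuous | exact: cover_continuous].
Qed.

Lemma int_linear_homeo (T T' : topologicalType) (P : V -> T) (P' : V -> T')
    (A B : V -> V) : torus_cover P -> torus_cover P' ->
  int_linear A -> int_linear B -> cancel A B -> cancel B A ->
  exists f : homeo T T', forall x, f (P x) = P' (A x).
Proof.
move=> hP hP' hA hB AK BK.
have [f cf fP] := int_linear_descends hP hP' hA.
have [h ch hP1] := int_linear_descends hP' hP hB.
have fK : cancel f h.
  by move=> p; have [x <-] := cover_surj hP p; rewrite fP hP1 AK.
have hK : cancel h f.
  by move=> p; have [x <-] := cover_surj hP' p; rewrite hP1 fP BK.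
by exists (Homeo fK hK cf ch).
Qed.

(** The segments from [A x] to [G x] form a homotopy which commutes with the
integer translations, as both maps have the same linear part. *)
Lemma homotopic_linear_part (T T' : topologicalType) (P : V -> T) (P' : V -> T')
    (f g : T -> T') (G A : V -> V) : torus_cover P -> torus_cover P' ->
  continuous G -> int_linear A ->
  (forall p, P' (G p) = g (P p)) -> (forall p, P' (A p) = f (P p)) ->
  (forall p n, int_vec n -> G (p + n) = G p + A n) ->
  homotopic R f g.
Proof.
move=> hP hP' cG hA Gg Af GA; have [s sK] := cover_section hP.
pose h (tx : R * V) := (1 - tx.1) *: A tx.2 + tx.1 *: G tx.2.
have hn t x n : int_vec n -> h (t, x + n) = h (t, x) + A n.
  move=> ni; rewrite /h /= GA // (int_linearD hA) !scalerDr addrACA -scalerDl.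
  by rewrite subrK scale1r.
have ch : continuous h.
  move=> tx; have ct : {for tx, continuous (fst : R * V -> R)} by exact: cvg_fst.
  have cx : {for tx, continuous (snd : R * V -> V)} by exact: cvg_snd.
  apply: cvgD; apply: cvgZ => //.
  - by apply: (@cvgB R R _ _ _ (cst 1) fst); [exact: cvg_cst | exact: ct].
  - by apply: continuous_comp cx _; exact: int_linear_continuous.
  - by apply: continuous_comp cx _; exact: cG.
have hP1 t x : P' (h (t, s (P x))) = P' (h (t, x)).
  have i1 : int_vec (s (P x) - x) by apply/(cover_eq hP).
  have -> : s (P x) = x + (s (P x) - x) by rewrite addrC subrK.
  rewrite hn //; apply/(cover_eq hP'); rewrite addrAC subrr add0r.
  exact: int_linear_int.
exists (fun tp : R * T => P' (h (tp.1, s tp.2))); split.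
- apply: continuous_subspaceT; apply: (cover_quotient_prod hP).
  have -> : (fun tx : R * V => P' (h (tx.1, s (P tx.2)))) = P' \o h.
    by apply/funext => -[t x] /=; rewrite hP1.
  by move=> tx; apply: continuous_comp; [exact: ch | exact: cover_continuous].
- by move=> p; rewrite /h /= subr0 scale1r scale0r addr0 Af sK.
- by move=> p; rewrite /h /= subrr scale1r scale0r add0r Gg sK.
Qed.

(** The map of tori induced by [A] is no more expanding than [A] itself. *)
Lemma int_linear_lipschitz (T T' : topologicalType) (P : V -> T) (P' : V -> T')
    (N N' : V -> R) (d : T -> T -> R) (d' : T' -> T' -> R)
    (f : T -> T') (A : V -> V) (M : R) :
  torus_cover P -> plane_norm N -> plane_norm N' ->
  flat_dist P N d -> flat_dist P' N' d' ->
  int_linear A -> (forall x, f (P x) = P' (A x)) -> torus_cover P' ->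
  0 < M -> (forall v, N' (A v) <= M * N v) ->
  (lipschitz_const d d' f <= M%:E)%E.
Proof.
move=> hP hN hN' hd hd' hA fP hP' M0 MA.
apply: ge_ereal_sup => _ [[p q] /= pq <-]; rewrite lee_fin.
rewrite ler_pdivrMr; last exact: (flat_dist_gt0 hP hN hd).
have [[a <-] [b <-]] := (cover_surj hP p, cover_surj hP q).
rewrite !fP -ler_pdivrMl // mulrC.
apply: (flat_dist_ge hd) => n ni; rewrite ler_pdivrMr // mulrC.
apply: le_trans (MA _); rewrite (int_linearD hA) (int_linearB _ _ hA).
by apply: (flat_dist_le hN' hd'); exact: int_linear_int.
Qed.

Lemma le_archi (x y : R) (H : forall K : nat, K%:R * x <= y) : x <= 0.
Proof.
rewrite leNgt; apply/negP => x0.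
have y0 : 0 <= y by have := H 0%N; rewrite mul0r.
have := H (Num.Def.archi_bound (y / x)); rewrite leNgt => /negP; apply.
by rewrite -ltr_pdivrMr //; apply: archi_boundP; rewrite divr_ge0 // ltW.
Qed.

(** The operator norm of [A] is already attained, as a supremum, on integer
vectors: multiples [K *: v] are within bounded distance of integer vectors. *)
Lemma int_linear_norm_le (N N' : V -> R) (A : V -> V) (M : R) :
  plane_norm N -> plane_norm N' -> int_linear A -> 0 <= M ->
  (forall n, int_vec n -> N' (A n) <= M * N n) ->
  forall v, N' (A v) <= M * N v.
Proof.
move=> hN hN' hA M0 MA v; rewrite -subr_le0.
have small (Q : V -> R) u : (forall u1 u2, Q (u1 + u2) <= Q u1 + Q u2) ->
    (forall (t : R) w, Q (t *: w) = `|t| * Q w) -> (forall w, 0 <= Q w) ->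
    0 <= u.1 <= 1 -> 0 <= u.2 <= 1 -> Q u <= Q (1, 0) + Q (0, 1).
  move=> QD QZ Q0 /andP[a0 a1] /andP[b0 b1]; rewrite [in leLHS](vec_basis u).
  apply: le_trans (QD _ _) _; rewrite !QZ !ger0_norm //.
  by apply: lerD; rewrite ler_piMl.
(* a bound for N' (A u) + M * N u on the unit square *)
pose C := M * (N (1, 0) + N (0, 1)) + (N' (A (1, 0)) + N' (A (0, 1))).
apply: (@le_archi _ C) => K.
(* the integer part of K *: v *)
pose w : V := ((Num.floor (K%:R * v.1))%:~R, (Num.floor (K%:R * v.2))%:~R).
have wi : int_vec w by rewrite /int_vec /= !intr_int.
have fl (t : R) : 0 <= t - (Num.floor t)%:~R <= 1.
  by have := floor_le_tmp t; have := floorD1_gt t; rewrite intrD; lra.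
have h1 := small N (K%:R *: v - w) (plane_normD hN) (plane_normZ hN)
  (plane_norm_ge0 hN) (fl _) (fl _).
have h2 := small (N' \o A) (K%:R *: v - w) _ _ _ (fl _) (fl _).
have {}h2 : N' (A (K%:R *: v - w)) <= N' (A (1, 0)) + N' (A (0, 1)).
  apply: h2.
  - by move=> u1 u2; rewrite /= (int_linearD hA); exact: plane_normD.
  - by move=> t u; rewrite /= (int_linearZ hA) plane_normZ.
  - by move=> u; exact: (plane_norm_ge0 hN').
have h3 : K%:R * N' (A v) <= N' (A w) + N' (A (K%:R *: v - w)).
  rewrite -{1}[K%:R]ger0_norm // -(plane_normZ hN') -(int_linearZ hA).
  by rewrite -{1}[K%:R *: v](subrK w) addrC (int_linearD hA) plane_normD.
have h4 : N w <= K%:R * N v + N (K%:R *: v - w).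
  rewrite -{1}[K%:R]ger0_norm // -(plane_normZ hN).
  rewrite -[in leRHS](plane_normN hN (_ - w)).
  apply: le_trans (plane_normD hN _ _).
  by rewrite opprB addrC subrK.
have h5 := MA w wi; rewrite /C mulrBr mulrCA; nra.
Qed.

(** The retraction of the line onto [0, 1]. *)
Definition clamp (t : R) : R := Num.max 0 (Num.min 1 t).

Lemma clamp_in t : clamp t \in `[0, 1].
Proof. by rewrite /clamp in_itv /= le_max lexx ge_max ge_min lexx ler01. Qed.

Lemma clamp_id t : t \in `[0, 1] -> clamp t = t.
Proof.
by rewrite /clamp in_itv /= => /andP[t0 t1]; rewrite min_r // max_r.
Qed.

Lemma clamp_continuous : continuous clamp.
Proof.
move=> t; apply: (@continuous_max R R (cst 0) (fun t => Num.min 1 t)).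
  exact: cst_continuous.
apply: (@continuous_min R R (cst 1) idfun); first exact: cst_continuous.
exact: cvg_id.
Qed.

Lemma continuous_retract (X Y Z : topologicalType) (A : set X) (f : X -> Y)
    (r : Z -> X) : {within A, continuous f} -> continuous r ->
  (forall z, A (r z)) -> continuous (f \o r).
Proof.
move=> /subspace_continuousP cf cr rA z W /(cf _ (rA z)) h.
have nz : nbhs z [set y | A (r y) -> W (f (r y))] by exact: cr z _ h.
have : nbhs z [set y | W (f (r y))] by apply: filterS nz => y; apply; exact: rA.
exact.
Qed.

(** The displacement between the ends of a lifted closed curve is invariant under
free homotopy. *)
Lemma free_homotopy_displacement (S T : topologicalType) (P : V -> T)
    (q : S -> T) (c c' : R -> S) (k : R -> V) :
  torus_cover P -> continuous q -> freely_homotopic c c' ->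
  continuous k -> (forall t, t \in `[0, 1] -> P (k t) = q (c t)) ->
  exists l : R -> V, [/\ continuous l, forall t, t \in `[0, 1] -> P (l t) = q (c' t)
    & l 1 - l 0 = k 1 - k 0].
Proof.
move=> hP cq [H [cH H0 H1 Hc]] ck kc.
pose r (st : V) : R * R := (clamp st.1, clamp st.2).
have cr : continuous r.
  move=> st; apply: (@continuous_pair V R R (clamp \o fst) (clamp \o snd)).
    by apply: continuous_comp; [exact: cvg_fst | exact: clamp_continuous].
  by apply: continuous_comp; [exact: cvg_snd | exact: clamp_continuous].
have [F cF FH] : exists2 F : V -> V, continuous F &
    forall st, P (F st) = (q \o (H \o r)) st.
  apply: lift_exists => // st; apply: continuous_comp; last exact: cq.
  by apply: (continuous_retract cH cr) => z; split; exact: clamp_in.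
have c1 s : continuous (fun t => F (s, t)).
  move=> t; apply: continuous_comp; last exact: cF.
  by apply: continuous_pair; [exact: cst_continuous | exact: cvg_id].
have c2 t : continuous (fun s => F (s, t)).
  move=> s; apply: continuous_comp; last exact: cF.
  by apply: continuous_pair; [exact: cvg_id | exact: cst_continuous].
have i0 : (0 : R) \in `[0, 1] by rewrite in_itv /= lexx ler01.
have i1 : (1 : R) \in `[0, 1] by rewrite in_itv /= lexx ler01.
have FE s t : s \in `[0, 1] -> t \in `[0, 1] -> P (F (s, t)) = q (H (s, t)).
  by move=> s1 t1; rewrite FH /= /r /= !clamp_id.
exists (fun t => F (1, t)); split=> [|t t01|]; first exact: c1.
  by rewrite FE // H1.
have e1 := lift_displacement hP (path_within (c2 1)) (path_within (c2 0)) _.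
have {}e1 : F (1, 1) - F (0, 1) = F (1, 0) - F (0, 0).
  by apply: e1 => s s01; rewrite !FE // Hc.
have e2 := lift_displacement hP (path_within (c1 0)) (path_within ck) _.
have {}e2 : F (0, 1) - F (0, 0) = k 1 - k 0.
  by apply: e2 => t t01; rewrite FE // H0 // kc.
rewrite -e2; apply: vec_ext;
  [move: (congr1 fst e1) | move: (congr1 snd e1)] => /=; lra.
Qed.

(** The free homotopy class of a curve, among closed curves. *)
Definition free_class (S : topologicalType) (c : R -> S) : set (R -> S) :=
  [set c' | closed_curve c' /\ freely_homotopic c c'].

(** No curve in the class is shorter than the common displacement of the lifts.
The metric is carried from [T] to [S] by [q]. *)
Lemma class_length_ge (S T : topologicalType) (P : V -> T) (N : V -> R)
    (d : T -> T -> R) (q : S -> T) (c : R -> S) (k : R -> V) :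
  torus_cover P -> plane_norm N -> flat_dist P N d -> continuous q ->
  continuous k -> (forall t, t \in `[0, 1] -> P (k t) = q (c t)) ->
  ((N (k 1 - k 0))%:E <= class_length (fun x y => d (q x) (q y))
     (free_class c))%E.
Proof.
move=> hP hN hd cq ck kc; apply: le_ereal_inf_tmp => _ [c' [_ cc'] <-].
have [l [cl lc' <-]] := free_homotopy_displacement hP cq cc' ck kc.
exact: (curve_length_ge hN hd cl lc').
Qed.

Lemma freely_homotopic_refl (S : topologicalType) (c : R -> S) :
  closed_curve c -> freely_homotopic c c.
Proof.
move=> [cc c01]; exists (fun st => c st.2); split => //.
apply/subspace_continuousP => -[s t] [_ /= t01].
move/subspace_continuousP : cc => /(_ t t01) cc W /cc nW.
exists (setT, [set t | t \in `[0, 1] -> W (c t)]); first split=> //=.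
  exact: filterT.
by move=> [s' t'] /= [_ h] [_ t'01]; exact: h.
Qed.

End Affine.

(** * Quotients of the complex plane by lattices *)

Section Torus.
Context {R : realType}.
Local Notation V := ((R * R)%type : normedModType R).
Local Notation C := (plane R).
Variable L : lattice R.

Let a1 := complex.Re (omega1 L).
Let b1 := complex.Im (omega1 L).
Let a2 := complex.Re (omega2 L).
Let b2 := complex.Im (omega2 L).
Let D := a1 * b2 - b1 * a2.

(** The point of the plane with coordinates [v] in the given basis of the lattice. *)
Definition lattice_coord (v : V) : C :=
  Complex (v.1 * complex.Re (omega1 L) + v.2 * complex.Re (omega2 L))
          (v.1 * complex.Im (omega1 L) + v.2 * complex.Im (omega2 L)).

(** The Euclidean norm, in lattice coordinates. *)
Definition lattice_norm (v : V) : R := modulus (lattice_coord v).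

Lemma lattice_det_neq0 : D != 0.
Proof.
have := lattice_nondeg L; rewrite /D /a1 /a2 /b1 /b2.
by case: (omega1 L) (omega2 L) => [x y] [z t] /=; rewrite mulNr.
Qed.

Lemma lattice_coordD u v : lattice_coord (u + v) = lattice_coord u + lattice_coord v.
Proof. by rewrite /lattice_coord /=; congr Complex; ring. Qed.

Lemma lattice_coordB u v : lattice_coord (u - v) = lattice_coord u - lattice_coord v.
Proof. by rewrite /lattice_coord /=; congr Complex; ring. Qed.

Lemma modulusE (z : C) :
  modulus z = Num.sqrt (complex.Re z ^+ 2 + complex.Im z ^+ 2).
Proof. by case: z. Qed.

Lemma modulus_normE (z : C) : `|z| = Complex (modulus z) 0.
Proof. by case: z. Qed.

Lemma norm_lt_real (z : C) (r : R) :
  (`|z| < (Complex r 0 : C)) = (modulus z < r).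
Proof. by rewrite modulus_normE ltcE [X in X && _]eqxx. Qed.

Lemma Re_le_modulus (z : C) : `|complex.Re z| <= modulus z.
Proof. by rewrite modulusE -sqrtr_sqr ler_wsqrtr // lerDl sqr_ge0. Qed.

Lemma Im_le_modulus (z : C) : `|complex.Im z| <= modulus z.
Proof. by rewrite modulusE -sqrtr_sqr ler_wsqrtr // lerDr sqr_ge0. Qed.

(** The coordinates of [z] in the basis of the lattice, by Cramer's rule. *)
Definition coord_inv (z : C) : V :=
  ((complex.Re z * b2 - complex.Im z * a2) / D,
   (complex.Im z * a1 - complex.Re z * b1) / D).

Lemma coord_invK : cancel coord_inv lattice_coord.
Proof.
have D0 := lattice_det_neq0.
case=> x y; rewrite /lattice_coord /= -/a1 -/b1 -/a2 -/b2.
by congr Complex; rewrite /D in D0 *; field.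
Qed.

Lemma lattice_coordK : cancel lattice_coord coord_inv.
Proof.
have D0 := lattice_det_neq0.
case=> x y; rewrite /coord_inv /= -/a1 -/b1 -/a2 -/b2.
by apply: vec_ext; rewrite /= /D in D0 *; field.
Qed.

Lemma coord_invB z w : coord_inv (z - w) = coord_inv z - coord_inv w.
Proof. by rewrite -{1}(coord_invK z) -{1}(coord_invK w) -lattice_coordB lattice_coordK. Qed.

Let S := `|a1| + `|b1| + `|a2| + `|b2|.

Lemma coord_inv_le z : `|coord_inv z| <= S / `|D| * modulus z.
Proof.
have D0 : 0 < `|D| by rewrite normr_gt0 lattice_det_neq0.
have bound (x y s t : R) : `|x| + `|y| <= S -> `|s| <= modulus z -> `|t| <= modulus z ->
    `|(s * x - t * y) / D| <= S / `|D| * modulus z.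
  move=> xy hs ht; rewrite normrM normfV mulrAC ler_pM2r ?invr_gt0 //.
  apply: le_trans (ler_normB _ _) _; rewrite !normrM.
  have := normr_ge0 s; have := normr_ge0 x; have := normr_ge0 y; nra.
have := normr_ge0 a1; have := normr_ge0 a2; have := normr_ge0 b1; have := normr_ge0 b2.
move=> ? ? ? ?; rewrite prod_normE ge_max /=; apply/andP; split.
  by apply: bound; rewrite ?Re_le_modulus ?Im_le_modulus // /S; lra.
by apply: bound; rewrite ?Re_le_modulus ?Im_le_modulus // /S; lra.
Qed.

Lemma lattice_plane_norm : plane_norm lattice_norm.
Proof.
have D0 : 0 < `|D| by rewrite normr_gt0 lattice_det_neq0.
split.
- by move=> u v; rewrite /lattice_norm lattice_coordD; exact: le_normcD.
- move=> t v; rewrite /lattice_norm !modulusE /= /GRing.scale /=.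
  rewrite -sqrtr_sqr -sqrtrM ?sqr_ge0 //; congr Num.sqrt; ring.
- exists (`|D| / (S + 1)).
    rewrite divr_gt0 // /S.
    have := normr_ge0 a1; have := normr_ge0 a2; have := normr_ge0 b1;
      have := normr_ge0 b2; lra.
  have S0 : 0 <= S by rewrite /S !addr_ge0.
  move=> v; rewrite mulrAC ler_pdivrMr; last by lra.
  have := coord_inv_le (lattice_coord v); rewrite lattice_coordK mulrAC ler_pdivlMr //.
  have : 0 <= lattice_norm v by rewrite /lattice_norm modulusE sqrtr_ge0.
  rewrite -/(lattice_norm v); nra.
Qed.

Lemma lt0_complex (e : C) : 0 < e -> exists2 r : R, 0 < r & e = Complex r 0.
Proof.
by case: e => x y; rewrite ltcE /= => /andP[/eqP -> x0]; exists x.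
Qed.

Lemma lattice_coord_continuous : continuous lattice_coord.
Proof.
move=> v; have [K K0 KN] := plane_norm_bound lattice_plane_norm.
apply/cvgrPdist_lt => _ /lt0_complex[r r0 ->]; near=> w.
rewrite -lattice_coordB norm_lt_real.
apply: le_lt_trans (KN _) _; rewrite mulrC -ltr_pdivlMr //; near: w.
by apply: cvgr_dist_lt; [exact: cvg_id | rewrite divr_gt0].
Unshelve. all: end_near. Qed.

Lemma coord_inv_continuous : continuous coord_inv.
Proof.
move=> z W /nbhs_ballP[e /= e0 eW].
have D0 : 0 < `|D| by rewrite normr_gt0 lattice_det_neq0.
have S0 : 0 <= S by rewrite /S !addr_ge0.
pose K := S / `|D| + 1.
have K0 : 0 < K by rewrite /K ltr_wpDl // divr_ge0 // ltW.
have eK : 0 < (Complex (e / K) 0 : C) by rewrite ltcE /= eqxx /= divr_gt0.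
have : nbhs z [set w | `|z - w| < (Complex (e / K) 0 : C)].
  by apply/nbhs_ballP; exists (Complex (e / K) 0) => // w; rewrite -ball_normE.
apply: filterS => w; rewrite /= norm_lt_real ltr_pdivlMr // => h.
apply: eW; rewrite -ball_normE /= -coord_invB.
apply: le_lt_trans (coord_inv_le _) _; apply: le_lt_trans h.
rewrite mulrC ler_wpM2l //; first by rewrite modulusE sqrtr_ge0.
by rewrite /K lerDl.
Qed.

(** The covering of the torus by coordinates in the basis of the lattice. *)
Definition torus_param (v : V) : torus L := torus_proj L (lattice_coord v).

Lemma lattice_coord_int (m n : int) :
  lattice_coord (m%:~R, n%:~R) = omega1 L *~ m + omega2 L *~ n.
Proof.
have h (w : C) (i : int) : w *~ i = Complex (i%:~R * complex.Re w) (i%:~R * complex.Im w).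
  rewrite -mulrzr (_ : i%:~R = Complex i%:~R 0 :> C).
    by case: w => x y; congr Complex; rewrite /=; ring.
  by rewrite -[RHS]/(real_complex R _) rmorph_int.
by rewrite !h.
Qed.

Lemma torus_projE z w : torus_proj L z = torus_proj L w <-> in_lattice L (z - w).
Proof.
split=> [/eqquotP /asboolP //|h]; apply/eqquotP; exact/asboolP.
Qed.

Lemma torus_param_eq x y :
  torus_param x = torus_param y <-> int_vec (x - y).
Proof.
rewrite torus_projE -lattice_coordB; split.
  move=> [m [n]]; rewrite -lattice_coord_int => /(can_inj lattice_coordK) ->.
  by rewrite /int_vec /= !intr_int.
move=> /andP[/intrP[m hm] /intrP[n hn]]; exists m, n.
by rewrite -lattice_coord_int -hm -hn; congr lattice_coord; apply: vec_ext.
Qed.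

Lemma torus_param_surj y : exists x, torus_param x = y.
Proof.
exists (coord_inv (repr y)); rewrite /torus_param coord_invK; exact: reprK.
Qed.

(** Openness: a neighbourhood of a preimage of a point is the translate of a
neighbourhood of any other preimage. *)
Lemma torus_param_cover : torus_cover torus_param.
Proof.
split; [| |exact: torus_param_surj|exact: torus_param_eq].
  move=> v; apply: continuous_comp; first exact: lattice_coord_continuous.
  exact: pi_continuous.
move=> U oU; rewrite /open /= /quotient_open openE => z /= [x Ux xz].
have i1 : int_vec (x - coord_inv z).
  by apply/torus_param_eq; rewrite xz /torus_param coord_invK.
set n := x - coord_inv z in i1.
have c : {for z, continuous (fun w => coord_inv w + n)}.
  apply: (@continuous_comp C V V coord_inv (fun v => v + n)).
    exact: coord_inv_continuous.
  by apply: cvgD; [exact: cvg_id | exact: cvg_cst].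
have : nbhs z [set w | U (coord_inv w + n)].
  by apply: c; apply: open_nbhs_nbhs; split=> //; rewrite /n addrC subrK.
apply: filterS => w Uw; exists (coord_inv w + n) => //.
rewrite -[RHS](_ : torus_param (coord_inv w) = _); last by rewrite /torus_param coord_invK.
by apply/torus_param_eq; rewrite addrAC subrr add0r.
Qed.

Lemma torus_flat_dist : flat_dist torus_param lattice_norm (@torus_dist R L).
Proof.
move=> a b; congr inf; apply/seteqP; split=> [_ [[z w] /= [za wb] <-]|_ [n ni <-]].
  have iz : int_vec (coord_inv z - a).
    by apply/torus_param_eq; rewrite /torus_param coord_invK.
  have iw : int_vec (coord_inv w - b).
    by apply/torus_param_eq; rewrite /torus_param coord_invK.
  exists ((coord_inv z - a) - (coord_inv w - b)); first exact: int_vecB.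
  rewrite /lattice_norm -[in RHS](coord_invK z) -[in RHS](coord_invK w) -lattice_coordB.
  by congr (modulus (lattice_coord _)); apply: vec_ext => /=; ring.
exists (lattice_coord (a + n), lattice_coord b); first split=> //=.
  by apply/torus_param_eq; rewrite addrAC subrr add0r.
rewrite -[LHS]/(modulus (lattice_coord (a + n) - lattice_coord b)).
by rewrite -lattice_coordB addrAC.
Qed.

End Torus.

(** * Comparison of lengths of curves and Lipschitz constants *)

Section Comparison.
Context {R : realType}.
Local Notation V := ((R * R)%type : normedModType R).
Local Open Scope ereal_scope.

(** The inverse homeomorphism. *)
Lemma homeo_sym (X Y : topologicalType) (f : homeo X Y) :
  exists g : homeo Y X, forall y, g y = hinv f y.
Proof.
by exists (Homeo (hinvK f) (hfunK f) (@hinv_continuous _ _ f) (@hfun_continuous _ _ f)).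
Qed.

Lemma flat_metric_cover (X : marked_surface R) (d : X -> X -> R) :
  flat_metric d -> exists (P : V -> X) (N : V -> R),
    [/\ torus_cover P, plane_norm N & flat_dist P N d].
Proof.
move=> [L [u [_ _ du]]]; have [g gE] := homeo_sym u.
exists (g \o torus_param L), (lattice_norm L); split.
- by apply: cover_comp; exact: torus_param_cover.
- exact: lattice_plane_norm.
- by move=> a b; rewrite du /= !gE !hinvK; exact: torus_flat_dist.
Qed.

Lemma le_lne (x y : \bar R) : x <= y -> lne x <= lne y.
Proof.
move=> xy; have [x0|x0] := leP x 0; first by rewrite le0_lneNy ?leNye.
by rewrite lee_lne // in_itv /= leey andbT; [exact: ltW | exact: le_trans (ltW x0) xy].
Qed.

(** In the degenerate cases the quotient is 0: either [y] is infinite, or [y] is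
0 and then so is [x]. *)
Lemma lee_div_of_mul (x y : \bar R) (k : R) : (0 <= k)%R -> 0 <= x -> 0 <= y ->
  x <= k%:E * y -> x / y <= k%:E.
Proof.
move=> k0 x0; case: y => [r| |] //; last first.
  by move=> _ _; rewrite invey mule0 lee_fin.
rewrite lee_fin le_eqVlt => /orP[/eqP <-|r0].
  rewrite mule0 => x0'; have -> : x = 0 by apply/eqP; rewrite eq_le x0 x0'.
  by rewrite mul0e lee_fin.
by rewrite inver gt_eqF // lee_pdivrMr.
Qed.

Lemma curve_length_ge0 (Y : Type) (d : Y -> Y -> R) (c : R -> Y) :
  (forall x y, (0 <= d x y)%R) -> 0 <= curve_length d c.
Proof.
move=> d0; apply: le_trans (ereal_sup_ubound _); last first.
  by exists [:: 1%R] => //; exact: itv_partition1.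
by rewrite lee_fin sumr_ge0.
Qed.

Lemma class_length_ge0 (Y : Type) (d : Y -> Y -> R) (A : set (R -> Y)) :
  (forall x y, (0 <= d x y)%R) -> 0 <= class_length d A.
Proof.
by move=> d0; apply: le_ereal_inf_tmp => _ [c _ <-]; exact: curve_length_ge0.
Qed.

Lemma curve_length_lipschitz (X Y : Type) (d : X -> X -> R) (d' : Y -> Y -> R)
    (f : X -> Y) (k : R) (c : R -> X) : (0 <= k)%R ->
  (forall x y, (d' (f x) (f y) <= k * d x y)%R) ->
  curve_length d' (f \o c) <= k%:E * curve_length d c.
Proof.
move=> k0 fk; apply: ge_ereal_sup => _ [s ps <-].
apply: (@le_trans _ _ (k%:E * (\sum_(0 <= n < size s)
    d (c (nth 0 (0 :: s) n)) (c (nth 0 s n)))%R%:E)).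
  by rewrite -EFinM lee_fin mulr_sumr; apply: ler_sum => n _; exact: fk.
by apply: lee_wpmul2l; rewrite ?lee_fin //; apply: ereal_sup_ubound; exists s.
Qed.

Lemma within_comp (X Y Z : topologicalType) (A : set X) (B : set Y)
    (f : X -> Y) (g : Y -> Z) : {within A, continuous f} ->
  {within B, continuous g} -> (forall x, A x -> B (f x)) ->
  {within A, continuous (g \o f)}.
Proof.
move=> /subspace_continuousP cf /subspace_continuousP cg AB.
apply/subspace_continuousP => x Ax W /(cg _ (AB x Ax)) nW.
have h : nbhs x [set y | A y -> B (f y) -> W (g (f y))] := cf x Ax _ nW.
have : nbhs x [set y | A y -> W (g (f y))].
  by apply: filterS h => y h Ay; apply: h => //; exact: AB.
exact.
Qed.

(** With [H] a free homotopy from [c] to [c'] and [Phi] a homotopy from [phi] to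
the change of marking, [m' (Phi (1 - s, m^-1 (H (s, t))))] is a free homotopy
from [c] to the image of [c'], so that no concatenation is needed. *)
Lemma freely_homotopic_comp (X X' S : topologicalType) (m : homeo X S)
    (m' : homeo X' S) (phi : X -> X') (c c' : R -> S) :
  homotopic R phi (hinv m' \o m) -> freely_homotopic c c' ->
  freely_homotopic c (m' \o phi \o hinv m \o c').
Proof.
move=> [Phi [cPhi Phi0 Phi1]] [H [cH H0 H1 Hc]].
exists (fun st => m' (Phi (1 - st.1, hinv m (H st)))%R); split.
- apply: (@within_comp _ _ _ _ setT _ m') => //; last first.
    by apply: continuous_subspaceT; exact: hfun_continuous.
  apply: (within_comp _ cPhi); last first.
    move=> [s t] [/= s01 _]; split => //=; rewrite !in_itv /= in s01 *.
    by move: s01; lra.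
  apply/subspace_continuousP => st st01.
  have c1 : {for st, continuous (fun st : R * R => (1 - st.1)%R)}.
    by apply: (@cvgB R R _ _ _ (cst 1%R) fst); [exact: cvg_cst | exact: cvg_fst].
  have : {within `[0%R, 1%R]%classic `*` `[0%R, 1%R]%classic,
      continuous (hinv m \o H)}.
    apply: (@within_comp _ _ _ _ setT) cH _ _ => //.
    by apply: continuous_subspaceT; exact: hinv_continuous.
  move=> /subspace_continuousP /(_ st st01) c2.
  exact: (cvg_pair (cvg_within_filter _ c1) c2).
- by move=> t t01; rewrite /= subr0 Phi1 /= hinvK hinvK H0.
- by move=> t t01; rewrite /= subrr Phi0 /= H1.
- by move=> s s01; rewrite /= Hc.
Qed.

(** A Lipschitz map in the homotopy class of the change of marking sends a free
homotopy class of curves to itself and stretches lengths by at most its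
constant. *)
Lemma class_length_lipschitz (X X' S : topologicalType) (m : homeo X S)
    (m' : homeo X' S) (d : X -> X -> R) (d' : X' -> X' -> R)
    (phi : homeo X X') (k : R) (c : R -> S) : (0 < k)%R ->
  (forall x y, (d' (phi x) (phi y) <= k * d x y)%R) ->
  homotopic R phi (hinv m' \o m) ->
  class_length (fun x y => d' (hinv m' x) (hinv m' y)) (free_class c) <=
  k%:E * class_length (fun x y => d (hinv m x) (hinv m y)) (free_class c).
Proof.
move=> k0 phik hphi; rewrite muleC -lee_pdivrMr //.
apply: le_ereal_inf_tmp => _ [c' [[cc' c'01] hc'] <-].
rewrite lee_pdivrMr // muleC.
apply: le_trans (ereal_inf_lbound _) _.
  exists (m' \o phi \o hinv m \o c'); last exact: erefl.
  split; last exact: freely_homotopic_comp.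
  split; last by rewrite /= c'01.
  apply: (@within_comp _ _ _ _ setT) cc' _ _ => //.
  apply: continuous_subspaceT => x; apply: continuous_comp.
    exact: hinv_continuous.
  by apply: continuous_comp; exact: hfun_continuous.
rewrite -[leLHS]/(curve_length d' (fun t => hinv m' (m' (phi (hinv m (c' t)))))).
rewrite (_ : (fun t => _) = phi \o (hinv m \o c')); last first.
  by apply/funext => t /=; rewrite hfunK.
exact: (curve_length_lipschitz _ (ltW k0) phik).
Qed.

Variables (X X' : marked_surface R).
Variables (d : X -> X -> R) (d' : X' -> X' -> R).
Hypotheses (hd : flat_metric d) (hd' : flat_metric d').

Lemma kappa_le_lambda : kappa d d' <= lambda d d'.
Proof.
have [P [N [hP hN dP]]] := flat_metric_cover hd.
have [P' [N' [hP' hN' dP']]] := flat_metric_cover hd'.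
apply: le_ereal_inf_tmp => _ [phi [lip hphi] <-]; apply: le_lne.
have ratio x y : x <> y ->
    (d' (phi x) (phi y) / d x y)%:E <= lipschitz_const d d' phi.
  by move=> xy; apply: ereal_sup_ubound; exists (x, y).
(* two distinct points, to see that the Lipschitz constant is positive *)
have xy : P (0, 0)%R <> P (1 / 2, 0)%R.
  move/(cover_eq hP) => /int_vec_lt1.
  rewrite prod_normE /= subrr normr0 sub0r normrN ger0_norm ?max_l //.
  by move/(_ _)/(congr1 fst) => /=; lra.
have phixy : phi (P (0, 0)%R) <> phi (P (1 / 2, 0)%R).
  by move/(can_inj (hfunK phi)).
have [k kE] : exists k, lipschitz_const d d' phi = k%:E.
  have := ratio _ _ xy; move: lip.
  by case: (lipschitz_const d d' phi) => // k; exists k.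
rewrite kE in ratio *.
have k0 : (0 < k)%R.
  have := ratio _ _ xy; rewrite lee_fin; apply: lt_le_trans.
  apply: divr_gt0; first exact: (flat_dist_gt0 hP' hN' dP').
  exact: (flat_dist_gt0 hP hN dP).
have phik x y : (d' (phi x) (phi y) <= k * d x y)%R.
  have [->|/eqP nxy] := pselect (x = y).
    by rewrite (flat_distxx hP hN dP) (flat_distxx hP' hN' dP') mulr0.
  rewrite -ler_pdivrMr -?lee_fin; first by apply: ratio; exact/eqP.
  by apply: (flat_dist_gt0 hP hN dP); exact/eqP.
apply: ge_ereal_sup => _ [_ [c [cc ec] <-] <-].
apply: lee_div_of_mul (ltW k0) _ _ (class_length_lipschitz c k0 phik hphi).
  by apply: class_length_ge0 => x y; exact: (flat_dist_ge0 hP' hN' dP').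
by apply: class_length_ge0 => x y; exact: (flat_dist_ge0 hP hN dP).
Qed.

(** The image of the segment from 0 to an integer vector [n] is a closed geodesic
and a shortest curve in its class. *)
Lemma segment_loop_class (T S : topologicalType) (P : V -> T) (N : V -> R)
    (d0 : T -> T -> R) (m : homeo T S) (n : V) :
  torus_cover P -> plane_norm N -> flat_dist P N d0 -> int_vec n -> n != 0%R ->
  let c := fun t : R => m (P (t *: n)%R) in
  [/\ closed_curve c, essential c &
    class_length (fun x y => d0 (hinv m x) (hinv m y)) (free_class c) =
    (N n)%:E].
Proof.
move=> hP hN hd0 ni n0 c.
have ck : continuous (fun t : R => (t *: n)%R).
  by move=> t; apply: cvgZr_tmp; exact: cvg_id.
have kc t : t \in `[0%R, 1%R] -> P (t *: n)%R = hinv m (c t).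
  by move=> _; rewrite hfunK.
have cc : closed_curve c.
  split; last first.
    rewrite /c scale0r scale1r; congr (m _); apply/(cover_eq hP).
    by rewrite sub0r int_vecN.
  apply: continuous_subspaceT => t.
  apply: (@continuous_comp _ _ _ (fun t : R => P (t *: n)%R) m); last exact: hfun_continuous.
  by apply: (@continuous_comp _ _ _ (fun t : R => (t *: n)%R) P);
    [exact: ck | exact: cover_continuous].
split=> //.
  move=> [y cy].
  have [l [cl ly]] := free_homotopy_displacement hP (@hinv_continuous _ _ m) cy ck kc.
  have cst0 : continuous (cst (l 0%R) : R -> V) by exact: cst_continuous.
  have -> := lift_displacement hP (path_within cl) (path_within cst0) _.
    by rewrite /= scale1r scale0r subrr subr0 => /esym/eqP; apply/negP.
  by move=> t t01; rewrite /= !ly // in_itv /= lexx ler01.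
apply/eqP; rewrite eq_le; apply/andP; split.
  apply: le_trans (ereal_inf_lbound _) _.
    by exists c; [split=> //; exact: freely_homotopic_refl | exact: erefl].
  rewrite -[leLHS]/(curve_length d0 (fun t => hinv m (m (P (t *: n)%R)))).
  rewrite (_ : (fun t => _) = fun t : R => P (t *: n)%R); last first.
    by apply/funext => t; rewrite hfunK.
  exact: curve_length_segment.
have := class_length_ge hP hN hd0 (@hinv_continuous _ _ m) ck kc.
by rewrite scale1r scale0r subr0.
Qed.

(** The affine map [phi] induced by the linear part [A] of the change of marking
achieves the bound: its Lipschitz constant is at most the supremum of the ratios
[N' (A n) / N n] over nonzero integer vectors [n], which are quotients of
lengths of classes of closed curves. *)
Lemma lambda_le_kappa : lambda d d' <= kappa d d'.
Proof.
have [P [N [hP hN dP]]] := flat_metric_cover hd.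
have [P' [N' [hP' hN' dP']]] := flat_metric_cover hd'.
pose m : homeo X (T2 R) := marking X; pose m' : homeo X' (T2 R) := marking X'.
pose g := hinv m' \o m; pose h := hinv m \o m'.
have gK : cancel g h by move=> x; rewrite /g /h /= hinvK hfunK.
have hK : cancel h g by move=> x; rewrite /g /h /= hinvK hfunK.
have cg : continuous g.
  by move=> x; apply: continuous_comp; [exact: hfun_continuous | exact: hinv_continuous].
have ch : continuous h.
  by move=> x; apply: continuous_comp; [exact: hfun_continuous | exact: hinv_continuous].
have [G cG Gg] : exists2 G : V -> V, continuous G & forall p, P' (G p) = (g \o P) p.
  apply: lift_exists => // p; apply: continuous_comp; last exact: cg.
  exact: cover_continuous.
have [H cH Hh] : exists2 H : V -> V, continuous H & forall p, P (H p) = (h \o P') p.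
  apply: lift_exists => // p; apply: continuous_comp; last exact: ch.
  exact: cover_continuous.
have [A hA GA] := lift_linear_part hP hP' cG Gg.
have [B hB HB] := lift_linear_part hP' hP cH Hh.
have AK := lift_linear_part_inv hP hP' gK cG cH Gg Hh hA hB GA HB.
have BK := lift_linear_part_inv hP' hP hK cH cG Hh Gg hB hA HB GA.
have [phi phiP] := int_linear_homeo hP hP' hA hB AK BK.
have hphi : homotopic R phi g.
  by apply: (homotopic_linear_part hP hP' cG hA Gg _ GA) => p; rewrite phiP.
rewrite /kappa; set M := ereal_sup _.
have ratio n : int_vec n -> n != 0%R -> (N' (A n) / N n)%:E <= M.
  move=> ni n0.
  have [cc ec len] := segment_loop_class m hP hN dP ni n0.
  set c := fun t : R => _ in cc ec len.
  apply: le_trans (ereal_sup_ubound _); last first.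
    by exists (free_class c); [exists c | exact: erefl].
  rewrite -/m -/m' [X in _ * X^-1]len.
  have Nn : (0 < N n)%R.
    rewrite lt_def plane_norm_ge0 // andbT; apply: contra n0 => /eqP.
    by move/(plane_norm_eq0 hN)/eqP.
  rewrite inver gt_eqF // EFinM; apply: lee_wpmul2r.
    by rewrite lee_fin invr_ge0 ltW.
  have kc t : t \in `[0%R, 1%R] -> P' (G (t *: n)%R) = hinv m' (c t).
    by move=> _; rewrite Gg.
  have cGn : continuous (fun t : R => G (t *: n)%R).
    move=> t; apply: (@continuous_comp _ _ _ (fun t : R => (t *: n)%R) G); last exact: cG.
    by apply: cvgZr_tmp; exact: cvg_id.
  have := class_length_ge hP' hN' dP' (@hinv_continuous _ _ m') cGn kc.
  rewrite scale1r scale0r -{1}[n]add0r GA // addrAC subrr add0r; exact.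
have e1 : ((1, 0)%R : V) != 0%R.
  by apply/eqP => /(congr1 fst) /= /eqP; rewrite oner_eq0.
have N0 (n : V) (Q : V -> R) : plane_norm Q -> n != 0%R -> (0 < Q n)%R.
  move=> hQ n0; rewrite lt_def plane_norm_ge0 // andbT; apply: contra n0 => /eqP.
  by move/(plane_norm_eq0 hQ)/eqP.
have Ae1 : A (1, 0)%R != 0%R.
  apply: contra e1 => /eqP A0; rewrite -[X in X == _]AK A0.
  by rewrite int_linear0.
have M0 : 0 < M.
  apply: lt_le_trans (ratio _ int_vec_basis1 e1).
  by rewrite lte_fin divr_gt0 // N0.
case ME : M M0 => [r| |] //; last by rewrite leey.
rewrite lte_fin => r0.
have rA : forall v, (N' (A v) <= r * N v)%R.
  apply: int_linear_norm_le => //; first exact: ltW.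
  move=> n ni; have [->|n0] := eqVneq n 0%R.
    by rewrite int_linear0 // !plane_norm0 // mulr0.
  by have := ratio n ni n0; rewrite ME lee_fin ler_pdivrMr // N0.
have lip := int_linear_lipschitz hP hN hN' dP dP' hA phiP hP' r0 rA.
apply: le_trans (ereal_inf_lbound _) (le_lne lip).
by exists phi => //; split=> //; exact: le_lt_trans lip (ltry _).
Qed.

End Comparison.

Theorem proposition5p2 (R : realType) (p p' : teichmuller R)
    (X X' : marked_surface R) (d : X -> X -> R) (d' : X' -> X' -> R)
    (hX : p X) (hX' : p' X') (hd : flat_metric d) (hd' : flat_metric d') :
  kappa d d' = lambda d d'.
Proof.
apply/eqP; rewrite eq_le kappa_le_lambda //=; exact: lambda_le_kappa.
Qed.
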